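(* Let $\mathbb{H}$ be a non-zero locally finite measure concentrated on $(0,\infty)$, let $H(z)=\mathbb{H}((0,z])$, and let $F(z)=2\int_0^z\sqrt{z-h}\,\mathrm{d}H(h)$ for $z\ge0$. Let $(\bar{F}_n)_{n\ge1}$ be a piecewise constant, strongly consistent estimator of $F$. Let $M>0$ and let $\hat{H}_n^M$ be the isotonic estimator of $H$ constructed from $\bar{F}_n$. Let $z\in[0,M)$. Then, with probability one, $$H(z-)\le\liminf_{n\to\infty}\hat{H}_n^M(z)\le\limsup_{n\to\infty}\hat{H}_n^M(z)\le H(z).$$ In particular, if $z$ is a continuity point of $H$, then $\lim_{n\to\infty}\hat{H}_n^M(z)=H(z)$ almost surely.
   Context: Setting: a Poisson process $\Psi$ on $\mathbb{R}^d\times(0,\infty)$ with intensity measure $\nu_d\times\mathbb{H}$ ($\nu_d$ Lebesgue measure) generates a Poisson–Laguerre tessellation of $\mathbb{R}^d$, whose intersection with a hyperplane (identified with $\mathbb{R}^{d-1}$) is the Poisson–Laguerre tessellation generated by a Poisson process $\eta$ on $\mathbb{R}^{d-1}\times(0,\infty)$ with intensity measure $\nu_{d-1}\times\mathbb{F}$, where $F(z)=\mathbb{F}((0,z])=2\int_0^z\sqrt{z-h}\,\mathrm{d}H(h)$. Locally finite means finite on bounded Borel sets, so $H(z)<\infty$ for all $z$. $H(z-)$ denotes the left limit, with $H(0-)=0$. Integrals $\int_0^z\cdot\,\mathrm{d}H$ are Lebesgue–Stieltjes integrals over $(0,z]$. ''Piecewise constant, strongly consistent estimator of $F$'' means: $(\bar{F}_n)_{n\ge1}$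 is a sequence of random functions (on the probability space supporting $\eta$), each $\bar{F}_n:[0,\infty)\to[0,\infty)$ being a non-decreasing, right-continuous step function with $\bar{F}_n(0)=0$ and finitely many jump locations $0<h_1<h_2<\dots<h_k<\infty$, $k=k(n)$ (depending on $n$ and random), such that with probability one $\lim_{n\to\infty}\bar{F}_n(z)=F(z)$ for all $z\ge0$. Isotonic estimator: for $z\ge 0$ let $$U_n(z)=\frac{2}{\pi}\int_0^z\sqrt{z-t}\,\mathrm{d}\bar{F}_n(t).$$ Let $z_M=\min\{h_k,M\}$ and let $U_n^M$ be the greatest convex minorant of $U_n$ on $[0,z_M]$, i.e. the greatest convex function on $[0,z_M]$ lying below $U_n$. With $U_n^{M,l}$ and $U_n^{M,r}$ the left- and right-derivatives of $U_n^M$, define $$\hat{H}_n^M(z)=\begin{cases}U_n^{M,r}(z)&\text{if }z\in[0,z_M),\\ U_n^{M,l}(z_M)&\text{if }z\ge z_M.\end{cases}$$ (Almost surely $k(n)\ge1$ for all large $n$, so this is well-defined for all large $n$.) *)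

(* Defs.v *)
From HB Require Import structures.
From mathcomp Require Import all_boot all_order all_algebra.
From mathcomp Require Import all_classical all_reals all_analysis.
Import Order.TTheory GRing.Theory Num.Theory.
Import numFieldNormedType.Exports.

Set Implicit Arguments.
Unset Strict Implicit.
Unset Printing Implicit Defensive.

Local Open Scope classical_set_scope.
Local Open Scope ring_scope.

Section measure_on_the_half_line.
Context {R : realType}.
Implicit Type mu : {measure set (measurableTypeR R) -> \bar R}.

Definition locally_finite mu : Prop :=
  forall A : set (measurableTypeR R),
    measurable A -> bounded_set (A : set R) -> (mu A < +oo)%E.

Definition concentrated_on_pos mu : Prop := mu (~` `]0, +oo[%classic) = 0%E.

(* The interval is empty for z <= 0, so this is H extended by 0 to the negative
   half-line; in particular the left limit at 0 is 0, and continuity at 0 is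
   the same as continuity at 0 of H restricted to [0, +oo[. *)
Definition Hfun mu (z : R) : R := fine (mu `]0, z]%classic).

(* Integrating with respect to mu is the same as integrating with respect to
   dH, since mu is the Lebesgue-Stieltjes measure of H. *)
Definition Ffun mu (z : R) : R :=
  2 * \int[mu]_(h in `]0, z]%classic) Num.sqrt (z - h).

Definition left_limit (f : R -> R) (z : R) : R := lim (f x @[x --> z^'-]).

End measure_on_the_half_line.

Section greatest_convex_minorant.
Context {R : realType}.
Implicit Types (f g : R -> R) (a b : R).

Definition convex_minorant f a b g : Prop :=
  convex_function (`[a, b] : set R^o) g /\
  forall x, a <= x <= b -> g x <= f x.

Definition is_gcm f a b g : Prop :=
  convex_minorant f a b g /\
  forall g', convex_minorant f a b g' -> forall x, a <= x <= b -> g' x <= g x.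

(* Only the values on [a, b] are determined; the default f is taken when f has
   no greatest convex minorant, which is excluded by gcmP below as soon as f
   has some convex minorant. *)
Definition gcm f a b : R -> R := xget f [set g | is_gcm f a b g].

Lemma gcmP f a b :
  (exists g, convex_minorant f a b g) -> is_gcm f a b (gcm f a b).
Proof.
move=> [g0 cg0]; pose S x := [set g x | g in [set g | convex_minorant f a b g]].
have S0 x : S x !=set0 by exists (g0 x), g0.
have Sub x : a <= x <= b -> ubound (S x) (f x).
  by move=> abx _ [g [_ gf]] <-; exact: gf.
have Sle x g : a <= x <= b -> convex_minorant f a b g -> g x <= sup (S x).
  move=> abx cg; apply: ub_le_sup; first by exists (f x); exact: Sub.
  by exists g.
rewrite /gcm; case: xgetP => [//|/(_ (fun x => sup (S x)))]; case; split.
- split=> [t x y xab yab|x abx]; last by apply: ge_sup => //; exact: Sub.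
  apply: ge_sup => // _ [g [cg gf]] <-.
  have xab' : a <= x <= b by move: xab; rewrite inE /= in_itv.
  have yab' : a <= y <= b by move: yab; rewrite inE /= in_itv.
  apply: le_trans (cg t x y xab yab) _.
  rewrite !convRE lerD// ler_wpM2l ?Sle//; first by rewrite subr_ge0.
- by move=> g' cg' x abx; exact: Sle.
Qed.

Definition left_derivative f (x : R) : R :=
  lim ((f (x + e) - f x) / e @[e --> 0^'-]).

Definition right_derivative f (x : R) : R :=
  lim ((f (x + e) - f x) / e @[e --> 0^'+]).

End greatest_convex_minorant.

Section estimators.
Context {R : realType}.

(* s lists, in increasing order, the jump locations of a step function f on
   [0, +oo[; f is constant on any interval [x, y] such that ]x, y] contains no
   point of s. *)
Definition jump_locations (f : R -> R) (s : seq R) : Prop :=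
  [/\ path <%R 0 s,
      forall h, h \in s -> ~ {for h, continuous f} &
      forall x y, 0 <= x -> x <= y -> {in s, forall h, ~~ (x < h <= y)} ->
        f x = f y].

(* Monotonicity and right-continuity of the paths are part of the type
   cumulative R R, and functions on [0, +oo[ vanishing at 0 are extended by 0
   to the negative half-line. *)
Definition piecewise_constant_estimator d (T : measurableType d)
    (Fbar : nat -> T -> cumulative R R) (h : nat -> T -> seq R) : Prop :=
  [/\ forall n z, measurable_fun [set: T] (fun w => Fbar n w z : R),
      forall n w z, z <= 0 -> Fbar n w z = 0 &
      forall n w, jump_locations (Fbar n w) (h n w)].

Definition strongly_consistent d (T : measurableType d) (P : probability T R)
    (Fbar : nat -> T -> cumulative R R) (F : R -> R) : Prop :=
  {ae P, forall w, forall z, 0 <= z -> Fbar n w z @[n --> \oo] --> F z}.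

Definition Ufun (f : cumulative R R) (z : R) : R :=
  2 / pi * \int[lebesgue_stieltjes_measure f]_(t in `]0, z]%classic) Num.sqrt (z - t).

(* s is the sequence of jump locations of f. If f has no jump then zM = 0 and
   the value of the estimator is irrelevant. *)
Definition isotonic_estimator (f : cumulative R R) (s : seq R) (M z : R) : R :=
  let zM := Num.min (last 0 s) M in
  let UM := gcm (Ufun f) 0 zM in
  if z < zM then right_derivative UM z else left_derivative UM zM.

End estimators.

(* Main.v *)
Require Import Defs.
From HB Require Import structures.
From mathcomp Require Import all_boot all_order all_algebra.
From mathcomp Require Import all_classical all_reals all_analysis.
From mathcomp Require Import measurable_realfun ring lra.
Import Order.TTheory GRing.Theory Num.Theory.
Import numFieldNormedType.Exports.

Local Open Scope classical_set_scope.
Local Open Scope ring_scope.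

(**
On the almost sure event where [Fbar n] converges to [F], everything is
deterministic. The Abel transform [2 / pi * \int_0^z sqrt (z - t) dF(t)] of [F]
is [V z = \int_0^z (z - h) dH(h)], which is convex with slopes between the values
of [H]; and [U_n] converges to [V] pointwise, hence uniformly on [0, M] because
[U_n] is nondecreasing and [V] is Lipschitz. Therefore, for large [n], [V - e] is
a convex minorant of [U_n], the greatest convex minorant of [U_n] is squeezed
between [V - e] and [U_n], and its right derivative at [z] is bounded by difference
quotients of [V] up to an error proportional to [e]. Since [F] is unbounded, the
last jump of [Fbar n] eventually exceeds [M], so that [z_M = M].

No integral with a singular kernel is needed for the Abel transform: with phi
= sqrt (z - .), both [\int phi dFbar_n] and [pi / 2 * V z] lie between the lower
and upper Stieltjes sums of phi, with respect to [Fbar n] and [F] respectively.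
For the latter it suffices to treat [2 * sqrt (t - h)] for a fixed [h], where the
substitution [t = h + (z - h) * sin^2 a] makes all functions smooth.
*)

(** * Finite sums of limits, and integrals of continuous functions over half-open intervals *)

Lemma cvg_sum_ord (R : realType) (I : Type) (F : set_system I) (FF : Filter F)
    (m : nat) (f : 'I_m -> I -> R) (l : 'I_m -> R) :
  (forall i, f i x @[x --> F] --> l i) ->
  (\sum_(i < m) f i x) @[x --> F] --> \sum_(i < m) l i.
Proof.
move=> fl; elim: m f l fl => [|m IH] f l fl.
  by under eq_fun do rewrite big_ord0; rewrite big_ord0; exact: cvg_cst.
under eq_fun do rewrite big_ord_recl; rewrite big_ord_recl.
by apply: cvgD; [exact: fl|exact: IH].
Qed.

Lemma continuous_integrable_oc (R : realType)
    (nu : {measure set (measurableTypeR R) -> \bar R}) (a b : R) (f : R -> R) :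
  (nu `]a, b]%classic < +oo)%E -> continuous f ->
  nu.-integrable `]a, b]%classic (EFin \o f).
Proof.
move=> fin cf; apply: measurable_bounded_integrable => //.
  exact: measurable_funS (continuous_measurable_fun cf).
have /compact_bounded[K [Kr KP]] :=
  continuous_compact (continuous_subspaceT cf) (@segment_compact R a b).
exists K; split => // x Kx y /= aby; apply: KP => //.
by exists y => //; apply: subset_itv_oc_cc.
Qed.

Lemma Rintegral_oc_cat (R : realType)
    (nu : {measure set (measurableTypeR R) -> \bar R}) (a b c : R) (f : R -> R) :
  a <= b -> b <= c -> (nu `]a, c]%classic < +oo)%E -> continuous f ->
  \int[nu]_(x in `]a, c]%classic) f x =
  \int[nu]_(x in `]a, b]%classic) f x + \int[nu]_(x in `]b, c]%classic) f x.
Proof.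
move=> ab bc fin cf.
have E : `]a, c]%classic = `]a, b]%classic `|` `]b, c]%classic :> set R.
  by rewrite -itv_bndbnd_setU // bnd_simp.
rewrite E Rintegral_setU //.
- by rewrite -E; exact: continuous_integrable_oc.
- apply/disj_setPRL => x /=; rewrite !in_itv /= => /andP[bx _].
  by apply/negP; rewrite negb_and -ltNge bx orbT.
Qed.

Lemma continuous_sqrtB (R : realType) (c : R) :
  continuous (fun t : R => Num.sqrt (c - t)).
Proof.
move=> t; apply: (@continuous_comp _ _ _ (fun t : R => c - t) Num.sqrt).
  by apply: cvgB; [exact: cvg_cst|exact: cvg_id].
exact: sqrt_continuous.
Qed.

Lemma continuous_Bl (R : realType) (c : R) : continuous (fun t : R => c - t).
Proof. by move=> t; apply: cvgB; [exact: cvg_cst|exact: cvg_id]. Qed.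

Section integral_over_half_open_interval.
Context {R : realType} (nu : {measure set (measurableTypeR R) -> \bar R}).
Context (a b : R) (nu_fin : (nu `]a, b]%classic < +oo)%E).
Implicit Type f : R -> R.

Lemma le_Rintegral_oc f g : continuous f -> continuous g ->
  (forall x, a < x <= b -> f x <= g x) ->
  \int[nu]_(x in `]a, b]%classic) f x <= \int[nu]_(x in `]a, b]%classic) g x.
Proof.
move=> cf cg fg; apply: le_Rintegral => //.
- exact: continuous_integrable_oc.
- exact: continuous_integrable_oc.
Qed.

Lemma Rintegral_oc_le_cst f c : continuous f ->
  (forall x, a < x <= b -> f x <= c) ->
  \int[nu]_(x in `]a, b]%classic) f x <= c * fine (nu `]a, b]%classic).
Proof.
move=> cf fc; rewrite -Rintegral_cst //.
by apply: le_Rintegral_oc => // x; exact: cvg_cst.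
Qed.

Lemma Rintegral_oc_ge_cst f c : continuous f ->
  (forall x, a < x <= b -> c <= f x) ->
  c * fine (nu `]a, b]%classic) <= \int[nu]_(x in `]a, b]%classic) f x.
Proof.
move=> cf fc; rewrite -Rintegral_cst //.
by apply: le_Rintegral_oc => // x; exact: cvg_cst.
Qed.

Lemma RintegralB_oc f g : continuous f -> continuous g ->
  \int[nu]_(x in `]a, b]%classic) (f x - g x) =
  \int[nu]_(x in `]a, b]%classic) f x - \int[nu]_(x in `]a, b]%classic) g x.
Proof.
by move=> cf cg; apply: RintegralB => //; exact: continuous_integrable_oc.
Qed.

Lemma RintegralZl_oc f c : continuous f ->
  \int[nu]_(x in `]a, b]%classic) (c * f x) =
  c * \int[nu]_(x in `]a, b]%classic) f x.
Proof.
by move=> cf; apply: RintegralZl => //; exact: continuous_integrable_oc.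
Qed.

Lemma Rintegral_oc_sum m (f : nat -> R -> R) : (forall i, continuous (f i)) ->
  \int[nu]_(x in `]a, b]%classic) (\sum_(i < m) f i x) =
  \sum_(i < m) \int[nu]_(x in `]a, b]%classic) f i x.
Proof.
move=> cf; elim: m => [|m IH].
  rewrite big_ord0.
  under eq_Rintegral do rewrite big_ord0.
  by rewrite Rintegral_cst // mul0r.
rewrite big_ord_recr /= -IH -RintegralD //.
- by apply: eq_Rintegral => x _; rewrite big_ord_recr.
- apply: continuous_integrable_oc => // x.
  by apply: cvg_sum_ord => i; exact: cf.
- exact: continuous_integrable_oc.
Qed.

End integral_over_half_open_interval.

(** * Lower and upper Stieltjes sums *)

Section stieltjes_sums.
Context {R : realType}.
Implicit Types (phi g : R -> R) (p : nat -> R) (m : nat).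

(** The name presumes [phi] nonincreasing and [g] nondecreasing: the right end of each cell then
    carries the smaller value of [phi]. *)
Definition lower_sum phi g p m : R :=
  \sum_(i < m) phi (p i.+1) * (g (p i.+1) - g (p i)).

Definition upper_sum phi g p m : R :=
  \sum_(i < m) phi (p i) * (g (p i.+1) - g (p i)).

(** Termwise, the two sums differ by at most [c] times an increment of [g], and these increments
    telescope. *)
Lemma upper_sum_le phi g p m c : (forall i, (i < m)%N -> g (p i) <= g (p i.+1)) ->
  (forall i, (i < m)%N -> phi (p i) <= phi (p i.+1) + c) ->
  upper_sum phi g p m <= lower_sum phi g p m + c * (g (p m) - g (p 0%N)).
Proof.
move=> gp phip.
rewrite /upper_sum /lower_sum -(telescope_sumr (g \o p)) // big_mkord.
rewrite mulr_sumr -big_split /=; apply: ler_sum => i _.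
by rewrite -mulrDl ler_wpM2r ?subr_ge0 ?gp // phip.
Qed.

Lemma cvg_lower_sum phi (f : nat -> R -> R) g p m :
  (forall i, (i <= m)%N -> f n (p i) @[n --> \oo] --> g (p i)) ->
  lower_sum phi (f n) p m @[n --> \oo] --> lower_sum phi g p m.
Proof.
move=> fg; apply: cvg_sum_ord => i.
apply: cvgMl_tmp; apply: cvgB; apply: fg => //.
exact: ltnW.
Qed.

Lemma cvg_upper_sum phi (f : nat -> R -> R) g p m :
  (forall i, (i <= m)%N -> f n (p i) @[n --> \oo] --> g (p i)) ->
  upper_sum phi (f n) p m @[n --> \oo] --> upper_sum phi g p m.
Proof.
move=> fg; apply: cvg_sum_ord => i.
apply: cvgMl_tmp; apply: cvgB; apply: fg => //.
exact: ltnW.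
Qed.

(** Induction on the number of cells: on a cell the monotone [phi] lies between its end values, and
    the mass of the cell is the increment of [g]. *)
Lemma stieltjes_sums_bound (nu : {measure set (measurableTypeR R) -> \bar R})
    phi g p m :
  {homo p : i j / (i <= j)%N >-> i <= j} ->
  (forall x y, x <= y -> nu `]x, y]%classic = (g y - g x)%:E) ->
  continuous phi -> {homo phi : x y / x <= y >-> y <= x} ->
  lower_sum phi g p m <= \int[nu]_(x in `]p 0%N, p m]%classic) phi x
    <= upper_sum phi g p m.
Proof.
move=> p_nd nuE cphi phi_ni; elim: m => [|m /andP[IHl IHu]].
  rewrite /lower_sum /upper_sum !big_ord0 set_itvoc0 Rintegral_set0 //.
  by rewrite lexx.
have pm : p m <= p m.+1 by exact: p_nd.
have p0 : p 0%N <= p m by exact: p_nd.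
have fin x y : x <= y -> (nu `]x, y]%classic < +oo)%E.
  by move=> xy; rewrite nuE // ltry.
rewrite /lower_sum /upper_sum !big_ord_recr /=.
rewrite (Rintegral_oc_cat _ nu _ _ _ _ p0 pm) //; last first.
  by apply: fin; exact: le_trans pm.
have gE : g (p m.+1) - g (p m) = fine (nu `]p m, p m.+1]%classic).
  by rewrite nuE.
apply/andP; split; apply: lerD => //; rewrite gE.
- by apply: Rintegral_oc_ge_cst => //; [exact: fin|move=> x /andP[_ ?]; exact: phi_ni].
- by apply: Rintegral_oc_le_cst => //; [exact: fin|move=> x /andP[? _]; apply/phi_ni/ltW].
Qed.

End stieltjes_sums.

(** * The Abel transform of a single square-root kernel *)

Section abel_kernel.
Context {R : realType}.
Implicit Types a b h s t z : R.

(** The derivative of [sin x * cos x + x] is [2 * cos x ^+ 2], that is, [2 * cos x] times the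
    derivative of [sin]. Subtracting [2 * c * sin x] leaves the derivative
    [2 * cos x * (cos x - c)], which has constant sign on [a, b] for [c = cos b] and for
    [c = cos a]; the mean value theorem concludes. *)
Lemma sincos_increment a b : 0 <= a -> a <= b -> b <= pi / 2 ->
  2 * cos b * (sin b - sin a) <=
    (sin b * cos b + b) - (sin a * cos a + a) <= 2 * cos a * (sin b - sin a).
Proof.
move=> a0 ab bpi.
pose P x : R := sin x * cos x + x.
have dP c (x : R) : is_derive x 1 (fun x => P x - 2 * c * sin x)
    (2 * cos x * (cos x - c)).
  rewrite /P; apply: is_derive_eq.
  rewrite /GRing.scale /=; have := cos2Dsin2 x.
  move=> /(congr1 (fun y => y - cos x ^+ 2)); rewrite addrC addKr => sE.
  by ring: sE.
have cpos (x : R) : x \in `[a, b] -> 0 <= cos x.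
  rewrite in_itv /= => /andP[ax xb]; apply: cos_ge0_pihalf.
  by apply/andP; split; have := pi_gt0 R; lra.
have cdec (x y : R) : 0 <= x -> x <= y -> y <= pi / 2 -> cos y <= cos x.
  move=> x0 xy ypi; have := pi_gt0 R => pi0.
  by rewrite leNgt; apply/negP; rewrite ltr_cos ?in_itv /=; try lra; apply/andP; split; lra.
have ct c : {within `[a, b], continuous (fun x => P x - 2 * c * sin x)}.
  apply: continuous_subspaceT => x.
  by apply: differentiable_continuous; apply/derivable1_diffP; case: (dP c x).
have ba : 0 <= b - a by rewrite subr_ge0.
apply/andP; split.
- have [x xab] := MVT_segment ab (fun x _ => dP (cos b) x) (ct (cos b)).
  have : 0 <= 2 * cos x * (cos x - cos b) * (b - a).
    move: xab; rewrite in_itv /= => /andP[ax xb].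
    by rewrite !mulr_ge0 // ?cpos ?in_itv /= ?ax // subr_ge0 cdec //; lra.
  by rewrite /P; lra.
- have [x xab] := MVT_segment ab (fun x _ => dP (cos a) x) (ct (cos a)).
  have : 2 * cos x * (cos x - cos a) * (b - a) <= 0.
    move: xab; rewrite in_itv /= => /andP[ax xb].
    rewrite mulr_le0_ge0 // mulr_ge0_le0 // ?mulr_ge0 // ?cpos ?in_itv /= ?ax //.
    by rewrite subr_le0 cdec //; lra.
  by rewrite /P; lra.
Qed.


(** [t = h + (z - h) * sin^2 (half_angle h z t)] for [h <= t <= z]; for [t <= h] the
    junk value [0] of [Num.sqrt] on negative numbers gives [half_angle h z t = 0]. *)
Definition half_angle h z t : R := asin (Num.sqrt ((t - h) / (z - h))).

Lemma half_angleP h z t : h < z -> t <= z ->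
  [/\ 0 <= half_angle h z t, half_angle h z t <= pi / 2,
      Num.sqrt (t - h) = Num.sqrt (z - h) * sin (half_angle h z t) &
      Num.sqrt (z - h) * cos (half_angle h z t) = Num.sqrt (z - Num.max h t)].
Proof.
move=> hz tz; rewrite /half_angle; set q := (t - h) / (z - h).
have zh0 : 0 < z - h by rewrite subr_gt0.
have qz : (z - h) * q = t - h by rewrite /q mulrC divfK // gt_eqF.
have q1 : q <= 1 by rewrite /q ler_pdivrMr // mul1r lerD2r.
have s0 : 0 <= Num.sqrt q := sqrtr_ge0 q.
have s1 : Num.sqrt q <= 1 by rewrite -sqrtr1 ler_wsqrtr.
have sI : -1 <= Num.sqrt q <= 1 by rewrite s1 andbT; lra.
have sinE : sin (asin (Num.sqrt q)) = Num.sqrt q.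
  by rewrite asinK // in_itv.
split.
- rewrite leNgt; apply/negP => neg.
  have := asin_geNpi2 sI => lb; have pi0 := pi_gt0 R.
  suff : sin (asin (Num.sqrt q)) < 0 by rewrite sinE ltNge s0.
  rewrite -[asin _]opprK sinN oppr_lt0; apply: sin_gt0_pi.
  by apply/andP; split; lra.
- exact: asin_lepi2.
- by rewrite sinE -sqrtrM ?(ltW zh0) // qz.
- rewrite cos_asin // -sqrtrM ?(ltW zh0) //.
  congr Num.sqrt; have [th|ht] := leP t h.
  + have q0 : q <= 0 by rewrite /q pmulr_lle0 ?invr_gt0 // subr_le0.
    by rewrite (ler0_sqrtr q0) expr0n /= subr0 mulr1.
  + have q0 : 0 <= q by rewrite /q divr_ge0 // ?(ltW zh0) // subr_ge0 ltW.
    by rewrite sqr_sqrtr // mulrBr mulr1 qz; ring.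
Qed.

(** The sine of the angle is proportional to [Num.sqrt (t - h)], which is nondecreasing in [t], and
    [sin] is strictly increasing on [0, pi / 2]. *)
Lemma half_angle_homo h z s t : h < z -> s <= t -> t <= z ->
  half_angle h z s <= half_angle h z t.
Proof.
move=> hz st tz; have sz := le_trans st tz.
have [s0 spi sE _] := half_angleP h z s hz sz.
have [t0 tpi tE _] := half_angleP h z t hz tz.
have pi0 := pi_gt0 R.
rewrite leNgt; apply/negP => lt_ts.
have := ler_wsqrtr (lerB st (lexx h)); rewrite sE tE.
rewrite ler_pM2l; last by rewrite sqrtr_gt0 subr_gt0.
by rewrite leNgt ltr_sin ?lt_ts // in_itv /=; apply/andP; split; lra.
Qed.

(** A primitive of [t |-> sqrt ((z - t) / (t - h))] on [h, z], constant before [h]. *)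
Definition abel_primitive h z t : R :=
  let a := half_angle h z t in (z - h) * (sin a * cos a + a).

(** This is [sincos_increment] at the two half angles, multiplied by [z - h]: one factor
    [Num.sqrt (z - h)] goes to the cosine and the other to the sines. *)
Lemma abel_increment h z s t : h < z -> s <= t -> t <= z ->
  Num.sqrt (z - t) * (2 * Num.sqrt (t - h) - 2 * Num.sqrt (s - h)) <=
    abel_primitive h z t - abel_primitive h z s <=
  Num.sqrt (z - s) * (2 * Num.sqrt (t - h) - 2 * Num.sqrt (s - h)).
Proof.
move=> hz st tz; have sz := le_trans st tz.
have [s0 spi sE sC] := half_angleP h z s hz sz.
have [t0 tpi tE tC] := half_angleP h z t hz tz.
have zh0 : 0 < z - h by rewrite subr_gt0.
have /andP[lo hi] := sincos_increment _ _ s0 (half_angle_homo _ _ _ _ hz st tz) tpi.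
have dG : 0 <= 2 * Num.sqrt (t - h) - 2 * Num.sqrt (s - h).
  by rewrite -mulrBr mulr_ge0 // subr_ge0 ler_wsqrtr // lerD2r.
rewrite /abel_primitive -(mulrBr (z - h)).
have rr : (z - h) = Num.sqrt (z - h) * Num.sqrt (z - h).
  by rewrite -expr2 sqr_sqrtr // ltW.
apply/andP; split.
- apply: le_trans _ (ler_wpM2l (ltW zh0) lo).
  rewrite [X in _ <= X * _]rr.
  (* The maximum differs from [t] only if [t <= h], and then the increment of the square roots is
     0. *)
  apply: (@le_trans _ _ (Num.sqrt (z - Num.max h t) *
    (2 * Num.sqrt (t - h) - 2 * Num.sqrt (s - h)))).
    have [//|th] := ltP h t.
    rewrite (ler0_sqrtr (_ : t - h <= 0)) ?subr_le0 //.
    by rewrite (ler0_sqrtr (_ : s - h <= 0)) ?subr_le0 ?(le_trans st) // subrr !mulr0.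
  by rewrite -tC tE sE le_eqVlt; apply/orP; left; apply/eqP; ring.
- apply: le_trans (ler_wpM2l (ltW zh0) hi) _.
  rewrite [X in X * _ <= _]rr.
  (* Here replacing the maximum by [s] can only enlarge the bound. *)
  apply: (@le_trans _ _ (Num.sqrt (z - Num.max h s) *
    (2 * Num.sqrt (t - h) - 2 * Num.sqrt (s - h)))).
    by rewrite -sC tE sE le_eqVlt; apply/orP; left; apply/eqP; ring.
  by apply: ler_wpM2r => //; rewrite ler_wsqrtr // lerB // le_max lexx orbT.
Qed.

(** Summing [abel_increment] over the cells, the middle terms telescope: the half angle runs from 0
    at [p 0] to pi / 2 at [z], so the primitive grows by [pi / 2 * (z - h)]. *)
Lemma abel_sums_bound h z (p : nat -> R) m :
  {homo p : i j / (i <= j)%N >-> i <= j} -> p m = z -> p 0%N <= h <= z ->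
  lower_sum (fun t => Num.sqrt (z - t)) (fun t => 2 * Num.sqrt (t - h)) p m
    <= pi / 2 * (z - h) <=
  upper_sum (fun t => Num.sqrt (z - t)) (fun t => 2 * Num.sqrt (t - h)) p m.
Proof.
move=> p_nd pm /andP[p0h hz].
set phi := fun t => Num.sqrt (z - t); set G := fun t => 2 * Num.sqrt (t - h).
have pz i : (i <= m)%N -> p i <= z by move=> im; rewrite -pm; exact: p_nd.
(* For [h = z] the half angle would involve a division by 0, but then [G] vanishes on the whole
   grid. *)
move: hz; rewrite le_eqVlt => /predU1P[hz|hz].
  have G0 i : (i <= m)%N -> G (p i) = 0.
    by move=> im; rewrite /G ler0_sqrtr ?mulr0 // hz subr_le0 pz.
  have dG (i : 'I_m) : G (p i.+1) - G (p i) = 0.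
    by rewrite !G0 ?subrr // ltnW.
  rewrite hz subrr mulr0 /lower_sum /upper_sum !big1 ?lexx // => i _;
  by rewrite dG mulr0.
have -> : pi / 2 * (z - h) =
    \sum_(i < m) (abel_primitive h z (p i.+1) - abel_primitive h z (p i)).
  rewrite -(big_mkord xpredT (fun i => _ (p i.+1) - _ (p i))) /=.
  rewrite (@telescope_sumr _ _ _ (abel_primitive h z \o p)) //= pm.
  have pi0 := pi_gt0 R.
  have zh0 : z - h != 0 by rewrite subr_eq0 gt_eqF.
  have az : half_angle h z z = pi / 2.
    rewrite /half_angle divff // sqrtr1 -[in LHS](@sin_pihalf R) sinK //.
    by rewrite in_itv /=; apply/andP; split; lra.
  have a0 : half_angle h z (p 0%N) = 0.
    rewrite /half_angle ler0_sqrtr; last first.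
      by rewrite pmulr_lle0 ?invr_gt0 ?subr_gt0 // subr_le0.
    rewrite -[in LHS](@sin0 R) sinK // in_itv /=.
    by apply/andP; split; lra.
  rewrite /abel_primitive az a0 sin0 cos_pihalf; ring.
have inc (i : 'I_m) := abel_increment h z (p i) (p i.+1) hz
  (p_nd _ _ (leqnSn i)) (pz _ (ltn_ord i)).
by apply/andP; split; apply: ler_sum => i _; have /andP[] := inc i.
Qed.

End abel_kernel.

Lemma le_sqrtD (R : rcfType) (x y : R) : 0 <= x -> 0 <= y ->
  Num.sqrt (x + y) <= Num.sqrt x + Num.sqrt y.
Proof.
move=> x0 y0; rewrite -ler_sqr ?nnegrE ?addr_ge0 ?sqrtr_ge0 //.
rewrite sqrrD !sqr_sqrtr ?addr_ge0 // -addrA lerD2l lerDr.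
by rewrite mulrn_wge0 // mulr_ge0 ?sqrtr_ge0.
Qed.

(** * Masses of half-open intervals, and the functions H, F and V *)

Lemma lebesgue_stieltjes_measure_oc (R : realType) (f : cumulative R R) (a b : R) :
  a <= b ->
  lebesgue_stieltjes_measure f `]a, b]%classic = (f b - f a)%:E.
Proof.
move=> ab; rewrite /lebesgue_stieltjes_measure /measure_extension /= measurable_mu_extE /=.
  by rewrite wlength_itv_bnd.
exact: is_ocitv.
Qed.

Lemma locally_finite_oc (R : realType)
    (mu : {measure set (measurableTypeR R) -> \bar R}) :
  locally_finite mu -> forall a b : R, (mu `]a, b]%classic < +oo)%E.
Proof.
move=> lf a b; apply: lf => //.
have /compact_bounded[K [Kr KP]] := @segment_compact R a b.
exists K; split => // x Kx y /= aby; apply: KP => //.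
exact: subset_itv_oc_cc.
Qed.

Section laguerre_section.
Context {R : realType} (mu : {measure set (measurableTypeR R) -> \bar R}).
Hypothesis mu_fin : forall a b : R, (mu `]a, b]%classic < +oo)%E.
Implicit Types (x y z t : R) (p : nat -> R) (m : nat).

(** The function V, the limit of the [Ufun (f n)]; by Fubini it is the integral of H over [0, z]. *)
Definition iterated_Hfun z : R := \int[mu]_(h in `]0, z]%classic) (z - h).

Lemma HfunD x y : 0 <= x -> x <= y ->
  Hfun mu y = Hfun mu x + fine (mu `]x, y]%classic).
Proof.
move=> x0 xy; have := Rintegral_oc_cat _ mu _ _ _ (cst 1) x0 xy (mu_fin _ _).
by rewrite !Rintegral_cst // !mul1r; apply; exact: cst_continuous.
Qed.

Lemma Hfun_homo : {homo Hfun mu : x y / x <= y}.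
Proof.
move=> x y xy; rewrite /Hfun fine_le ?ge0_fin_numE ?mu_fin //.
by apply: le_measure; rewrite ?inE //; apply: subset_itvl; rewrite bnd_simp.
Qed.

Lemma Hfun_nonpos x : x <= 0 -> Hfun mu x = 0.
Proof.
by move=> x0; rewrite /Hfun set_itv_ge ?measure0 // bnd_simp -leNgt.
Qed.

(** The increment is [(y - x) * Hfun mu x] plus the integral of [y - h] over ]x, y], whose integrand
    lies between 0 and [y - x]. Thus H provides slopes of supporting lines of V. *)
Lemma iterated_Hfun_increment x y : 0 <= x -> x <= y ->
  (y - x) * Hfun mu x <= iterated_Hfun y - iterated_Hfun x
    <= (y - x) * Hfun mu y.
Proof.
move=> x0 xy; rewrite /iterated_Hfun.
have cB c : continuous (fun h : R => c - h) := @continuous_Bl R c.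
rewrite (Rintegral_oc_cat _ mu _ _ _ _ x0 xy (mu_fin _ _) (cB y)).
have -> : \int[mu]_(h in `]0, x]%classic) (y - h) =
    (y - x) * Hfun mu x + \int[mu]_(h in `]0, x]%classic) (x - h).
  rewrite -Rintegral_cst // -RintegralD //.
  - by apply: eq_Rintegral => h _; rewrite addrA subrK.
  - by apply: continuous_integrable_oc => // ?; exact: cvg_cst.
  - exact: continuous_integrable_oc.
have lo : 0 <= \int[mu]_(h in `]x, y]%classic) (y - h).
  by apply: Rintegral_ge0 => h /=; rewrite in_itv /= subr_ge0 => /andP[].
have hi : \int[mu]_(h in `]x, y]%classic) (y - h) <=
    (y - x) * fine (mu `]x, y]%classic).
  by apply: Rintegral_oc_le_cst => // h /andP[xh _]; rewrite lerB // ltW.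
by rewrite (HfunD _ _ x0 xy) mulrDr; lra.
Qed.

(** [Num.sqrt] vanishes on negative numbers, so that the domain of integration can be
    made independent of [t]. *)
Lemma FfunE t z : 0 <= t -> t <= z ->
  Ffun mu t = \int[mu]_(h in `]0, z]%classic) (2 * Num.sqrt (t - h)).
Proof.
move=> t0 tz; have cs := @continuous_sqrtB R t.
rewrite RintegralZl_oc // (Rintegral_oc_cat _ mu _ _ _ _ t0 tz) //.
suff -> : \int[mu]_(h in `]t, z]%classic) Num.sqrt (t - h) = 0 by rewrite addr0.
under eq_Rintegral.
  move=> h; rewrite inE /= in_itv /= => /andP[th _].
  rewrite ler0_sqrtr ?subr_le0 ?ltW //; over.
by rewrite Rintegral_cst // mul0r.
Qed.

Lemma continuous_sqrt_kernel t : continuous (fun h => 2 * Num.sqrt (t - h) : R).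
Proof. by move=> h; apply: cvgMl_tmp; exact: continuous_sqrtB. Qed.

Lemma Ffun_homo x y : 0 <= x -> x <= y -> Ffun mu x <= Ffun mu y.
Proof.
move=> x0 xy; rewrite (FfunE x y) // (FfunE y y) ?(le_trans x0) //.
apply: le_Rintegral_oc => //; try exact: continuous_sqrt_kernel.
by move=> h _; rewrite ler_pM2l // ler_wsqrtr // lerD2r.
Qed.

Lemma Ffun0 : Ffun mu 0 = 0.
Proof. by rewrite /Ffun set_itvoc0 Rintegral_set0 mulr0. Qed.

(** By linearity, a Stieltjes sum against F is a mixture over [h] of Stieltjes sums against
    [2 * sqrt (t - h)], to which [abel_sums_bound] applies for each fixed [h]. *)
Lemma sum_FfunE z p m (c : nat -> R) :
  (forall i, (i <= m)%N -> 0 <= p i <= z) ->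
  \sum_(i < m) c i * (Ffun mu (p i.+1) - Ffun mu (p i)) =
  \int[mu]_(h in `]0, z]%classic)
    \sum_(i < m) c i * (2 * Num.sqrt (p i.+1 - h) - 2 * Num.sqrt (p i - h)).
Proof.
move=> pz.
have ck (i : nat) : continuous
    (fun h => 2 * Num.sqrt (p i.+1 - h) - 2 * Num.sqrt (p i - h) : R).
  by move=> h; apply: cvgB; exact: continuous_sqrt_kernel.
rewrite (Rintegral_oc_sum mu 0 z (mu_fin _ _) m
  (fun i h => c i * (2 * Num.sqrt (p i.+1 - h) - 2 * Num.sqrt (p i - h)))).
  apply: eq_bigr => i _; rewrite RintegralZl_oc // RintegralB_oc //;
    try exact: continuous_sqrt_kernel.
  have /andP[? ?] := pz i.+1 (ltn_ord i).
  have /andP[? ?] := pz i (ltnW (ltn_ord i)).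
  by rewrite -!FfunE.
by move=> i h; apply: cvgMl_tmp; exact: ck.
Qed.

Lemma Ffun_sums_bound z p m : {homo p : i j / (i <= j)%N >-> i <= j} ->
  p 0%N = 0 -> p m = z ->
  lower_sum (fun t => Num.sqrt (z - t)) (Ffun mu) p m
    <= pi / 2 * iterated_Hfun z <=
  upper_sum (fun t => Num.sqrt (z - t)) (Ffun mu) p m.
Proof.
move=> p_nd p0 pm.
have pz i : (i <= m)%N -> 0 <= p i <= z.
  by move=> im; rewrite -pm -p0 !p_nd.
have cs (c : nat -> R) : continuous (fun h => \sum_(i < m)
    c i * (2 * Num.sqrt (p i.+1 - h) - 2 * Num.sqrt (p i - h)) : R).
  move=> h; apply: cvg_sum_ord => i; apply: cvgMl_tmp.
  by apply: cvgB; exact: continuous_sqrt_kernel.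
rewrite /lower_sum /upper_sum.
rewrite (sum_FfunE z p m (fun i => Num.sqrt (z - p i.+1)) pz).
rewrite (sum_FfunE z p m (fun i => Num.sqrt (z - p i)) pz).
have cB := @continuous_Bl R z.
rewrite -(RintegralZl_oc mu 0 z (mu_fin _ _) _ _ cB).
have cZ : continuous (fun h => pi / 2 * (z - h) : R).
  by move=> h; apply: cvgMl_tmp; exact: cB.
apply/andP; split; apply: le_Rintegral_oc => //.
- exact: (cs (fun i => Num.sqrt (z - p i.+1))).
- move=> h /andP[h0 hz].
  have ph : p 0%N <= h <= z by rewrite p0 (ltW h0).
  by have /andP[? _] := abel_sums_bound h z p m p_nd pm ph.
- exact: (cs (fun i => Num.sqrt (z - p i))).
- move=> h /andP[h0 hz].
  have ph : p 0%N <= h <= z by rewrite p0 (ltW h0).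
  by have /andP[_ ?] := abel_sums_bound h z p m p_nd pm ph.
Qed.

End laguerre_section.

(** * Chord slopes and one-sided derivatives of convex functions *)

Section convex_slopes.
Context {R : realType}.
Implicit Types (f g V H : R -> R) (a b x y z : R).

(** Monotonicity of chord slopes from [x], in a form free of division. *)
Lemma convex_three_points g a b x y z :
  convex_function (`[a, b] : set R^o) g ->
  a <= x -> x < y -> y < z -> z <= b ->
  (g y - g x) * (z - x) <= (g z - g x) * (y - x).
Proof.
move=> cg ax xy yz zb.
have xz : 0 < z - x by rewrite subr_gt0 (lt_trans xy).
(* The weight for which [y = t * x + (1 - t) * z]. *)
pose t := (z - y) / (z - x).
have t01 : 0 <= t <= 1.
  apply/andP; split; first by rewrite divr_ge0 // subr_ge0 ltW // (lt_trans xy).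
  by rewrite ler_pdivrMr // mul1r lerD2l lerN2 ltW.
have xab : x \in (`[a, b]%classic : set R^o).
  by rewrite inE /= in_itv /= ax; lra.
have zab : z \in (`[a, b]%classic : set R^o).
  by rewrite inE /= in_itv /= zb andbT; lra.
have := cg (Itv01 (proj1 (andP t01)) (proj2 (andP t01))) x z xab zab.
rewrite !convRE /= /unstable.onem.
have txz : t * (z - x) = z - y by rewrite /t divfK // gt_eqF.
rewrite [X in g X <= _](_ : _ = t * x + (1 - t) * z) //.
rewrite (_ : t * x + (1 - t) * z = y); last by lra.
move=> /(ler_wpM2r (ltW xz)).
have -> : (t * g x + (1 - t) * g z) * (z - x) =
  g x * (t * (z - x)) + g z * (z - x - t * (z - x)) by ring.
by rewrite txz; lra.
Qed.

(** The line of slope [H c] through the point of the graph above [c] supports V. Averaging this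
    inequality at [x] and [y], with [c] their convex combination, cancels the linear terms. *)
Lemma subgradient_convex V H a b :
  {homo H : x y / x <= y} ->
  (forall x y, a <= x -> x <= y -> y <= b ->
    (y - x) * H x <= V y - V x <= (y - x) * H y) ->
  convex_function (`[a, b] : set R^o) V.
Proof.
move=> H_nd VH t x y; rewrite !inE /= !in_itv /= => /andP[ax xb] /andP[ay yb].
have s0 : 0 <= t%:num :> R by [].
have s1 : t%:num <= 1 :> R by [].
rewrite !convRE /=; move: s0 s1; set s : R := t%:num => s0 s1.
set r := unstable.onem s.
have r0 : 0 <= r by rewrite subr_ge0.
have sr : s + r = 1 by rewrite /r /unstable.onem addrC subrK.
set c := s * x + r * y.
rewrite [X in V X <= _](_ : _ = c) //.
have ac : a <= c.
  have : s * a + r * a <= c by rewrite lerD // ler_wpM2l.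
  by rewrite -mulrDl sr mul1r.
have cb : c <= b.
  have : c <= s * b + r * b by rewrite lerD // ler_wpM2l.
  by rewrite -mulrDl sr mul1r.
have sub u : a <= u -> u <= b -> V c + H c * (u - c) <= V u.
  move=> au ub; have [cu|/ltW uc] := leP c u.
    by have /andP[? _] := VH c u ac cu ub; lra.
  by have /andP[_ ?] := VH u c au uc cb; lra.
have := lerD (ler_wpM2l s0 (sub x ax xb)) (ler_wpM2l r0 (sub y ay yb)).
suff -> : s * (V c + H c * (x - c)) + r * (V c + H c * (y - c)) = V c by [].
have -> : s * (V c + H c * (x - c)) + r * (V c + H c * (y - c)) =
  (s + r) * V c + H c * (s * x + r * y - (s + r) * c) by ring.
by rewrite sr !mul1r -/c subrr mulr0 addr0.
Qed.

(** By convexity the difference quotient is nondecreasing in the increment. The lower bound [B]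
    makes its limit at 0 finite; without it the slope could be minus infinity at [z = a]. *)
Lemma right_derivative_bounds g a b z e B :
  convex_function (`[a, b] : set R^o) g -> a <= z -> 0 < e -> z + e <= b ->
  (forall x, 0 < x -> x <= e -> B <= (g (z + x) - g z) / x) ->
  B <= right_derivative g z <= (g (z + e) - g z) / e.
Proof.
move=> cg az e0 zeb lb.
pose q x := (g (z + x) - g z) / x.
have q_nd x y : 0 < x -> x <= y -> y <= e -> q x <= q y.
  move=> x0; rewrite le_eqVlt => /predU1P[->//|xy] ye.
  have y0 := lt_trans x0 xy.
  rewrite /q ler_pdivrMr // mulrAC ler_pdivlMr //.
  have := convex_three_points g a b z (z + x) (z + y) cg az.
  rewrite ltrDl ltrD2l => /(_ x0 xy).
  rewrite -[z + x - z]addrAC subrr add0r -[z + y - z]addrAC subrr add0r.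
  by apply; lra.
have qe : cvg (q x @[x --> 0^'+]).
  apply/cvg_ex; eexists; apply: (@nondecreasing_at_right_cvgr _ q 0 (BRight e)).
  - by rewrite bnd_simp.
  - move=> x y; rewrite !in_itv /= => /andP[x0 _] /andP[_ ye] xy.
    exact: q_nd.
  - by exists B => _ [x /= + <-]; rewrite in_itv /= => /andP[? ?]; exact: lb.
have near_e : \forall x \near (0 : R)^'+, 0 < x <= e.
  near=> x; apply/andP; split; near: x; first exact: nbhs_right_gt.
  exact: nbhs_right_le.
apply/andP; split.
- apply: limr_ge => //; apply: filterS near_e => x /andP[]; exact: lb.
- apply: limr_le => //; apply: filterS near_e => x /andP[x0 xe]; exact: q_nd.
Unshelve. all: by end_near. Qed.

End convex_slopes.

(** * Convergence of U_n to V, pointwise and then uniformly from below *)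

Section Ufun_theory.
Context {R : realType}.
Implicit Types (f : cumulative R R) (x y z : R).

Lemma Ufun_sums_bound f z (p : nat -> R) m :
  {homo p : i j / (i <= j)%N >-> i <= j} -> p 0%N = 0 -> p m = z ->
  lower_sum (fun t => Num.sqrt (z - t)) f p m <= pi / 2 * Ufun f z <=
  upper_sum (fun t => Num.sqrt (z - t)) f p m.
Proof.
move=> p_nd p0 pm; rewrite /Ufun mulrA mulf_div (mulrC pi) divff ?mul1r; last first.
  by rewrite mulf_neq0 // gt_eqF // pi_gt0.
have := stieltjes_sums_bound (lebesgue_stieltjes_measure f)
  (fun t => Num.sqrt (z - t)) f p m p_nd.
rewrite p0 pm; apply.
- by move=> x y; exact: lebesgue_stieltjes_measure_oc.
- exact: continuous_sqrtB.
- by move=> x y xy; rewrite ler_wsqrtr // lerD2l lerN2.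
Qed.

Lemma Ufun_ge0 f z : 0 <= Ufun f z.
Proof.
rewrite /Ufun mulr_ge0 ?divr_ge0 ?pi_ge0 //.
by apply: Rintegral_ge0 => t _; exact: sqrtr_ge0.
Qed.

Lemma Ufun0 f : Ufun f 0 = 0.
Proof. by rewrite /Ufun set_itvoc0 Rintegral_set0 mulr0. Qed.

Lemma Ufun_homo f x y : 0 <= x -> x <= y -> Ufun f x <= Ufun f y.
Proof.
move=> x0 xy; rewrite /Ufun ler_wpM2l ?divr_ge0 ?pi_ge0 //.
have fin a b : a <= b ->
    (lebesgue_stieltjes_measure f `]a, b]%classic < +oo)%E.
  by move=> ab; rewrite lebesgue_stieltjes_measure_oc // ltry.
have y0 := le_trans x0 xy.
rewrite (Rintegral_oc_cat _ (lebesgue_stieltjes_measure f) 0 x y _ x0 xy (fin _ _ y0)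
  (@continuous_sqrtB R y)).
apply: le_trans (_ : _ <= _ + 0) _; last first.
  by apply: lerD; [exact: lexx|apply: Rintegral_ge0 => t _; exact: sqrtr_ge0].
rewrite addr0; apply: le_Rintegral_oc; try exact: continuous_sqrtB.
- exact: fin.
- by move=> t _; rewrite ler_wsqrtr // lerD2r.
Qed.

(** Subadditivity of the square root gives a bound that is uniform over the cells, including those
    near [z], where [sqrt (z - t)] is not Lipschitz. *)
Lemma uniform_grid_step z m i : 0 <= z -> (i <= m)%N ->
  Num.sqrt (z - z * i%:R / m.+1%:R) <=
  Num.sqrt (z - z * i.+1%:R / m.+1%:R) + Num.sqrt (z / m.+1%:R).
Proof.
move=> z0 im; apply: le_trans (le_sqrtD _ _ _ _ _).
- by rewrite ler_wsqrtr // -[i.+1%:R]natr1 mulrDr mulr1 mulrDl opprD addrA subrK.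
- by rewrite subr_ge0 ler_pdivrMr // ler_wpM2l // ler_nat.
- by rewrite divr_ge0.
Qed.

(** On a fixed grid the sums against [f n] converge to those against F, being finite sums; a fine
    grid makes the gap between lower and upper sums small. *)
Lemma cvg_Ufun (mu : {measure set (measurableTypeR R) -> \bar R})
    (f : nat -> cumulative R R) z :
  (forall a b : R, (mu `]a, b]%classic < +oo)%E) -> 0 <= z ->
  (forall y : R, 0 <= y -> f n y @[n --> \oo] --> Ffun mu y) ->
  Ufun (f n) z @[n --> \oo] --> iterated_Hfun mu z.
Proof.
move=> mu_fin z0 fF; have pi0 : 0 < pi :> R := pi_gt0 R.
suff : pi / 2 * Ufun (f n) z @[n --> \oo] --> pi / 2 * iterated_Hfun mu z.
  have piK x : x = 2 / pi * (pi / 2 * x).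
    by rewrite mulrA mulf_div (mulrC pi) divff ?mul1r // mulf_neq0 // gt_eqF.
  move=> cv; rewrite (piK (iterated_Hfun mu z)).
  by under eq_fun do rewrite [Ufun _ _]piK; exact: cvgMl_tmp.
apply/cvgrPdist_lt => e e0.
have F0 : 0 <= Ffun mu z by rewrite -(Ffun0 mu); exact: Ffun_homo.
(* The gap between the sums will be at most [d * Ffun mu z < e / 2]; adding 1 avoids a division by
   0. *)
pose d := e / 2 / (Ffun mu z + 1).
have d0 : 0 < d by rewrite !divr_gt0 // ltr_wpDl.
have dF : d * Ffun mu z < e / 2.
  by rewrite /d mulrAC ltr_pdivrMr ?ltr_wpDl // ltr_pM2l ?divr_gt0 // ltrDl.
(* With this many cells the mesh is at most [d ^+ 2], so [phi] varies by at most [d] on a cell. *)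
pose m := Num.bound (z / d ^+ 2).
have zm : Num.sqrt (z / m.+1%:R) <= d.
  rewrite -[leRHS]ger0_norm ?(ltW d0) // -sqrtr_sqr ler_wsqrtr //.
  rewrite ler_pdivrMr // mulrC -ler_pdivrMr ?exprn_gt0 //.
  rewrite ltW // (lt_trans (archi_boundP _)) ?ltr_nat //.
  by rewrite divr_ge0 // sqr_ge0.
pose p i : R := z * i%:R / m.+1%:R.
have p0 : p 0%N = 0 by rewrite /p mulr0 mul0r.
have pm : p m.+1 = z by rewrite /p mulfK // pnatr_eq0.
have p_nd : {homo p : i j / (i <= j)%N >-> i <= j}.
  by move=> i j ij; rewrite /p ler_wpM2r ?invr_ge0 // ler_wpM2l // ler_nat.
have p_ge0 i : 0 <= p i by rewrite -p0; exact: p_nd.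
pose phi t := Num.sqrt (z - t).
have ul : upper_sum phi (Ffun mu) p m.+1 <=
    lower_sum phi (Ffun mu) p m.+1 + d * Ffun mu z.
  have := upper_sum_le phi (Ffun mu) p m.+1 d.
  rewrite p0 pm Ffun0 subr0; apply.
  - by move=> i _; apply: Ffun_homo => //; exact: p_nd.
  - move=> i im; apply: le_trans (uniform_grid_step z m i z0 im) _.
    exact: lerD.
have /andP[Vl Vu] := Ffun_sums_bound mu mu_fin z p m.+1 p_nd p0 pm.
have lcv := cvg_lower_sum phi (fun n => f n) (Ffun mu) p m.+1
  (fun i _ => fF (p i) (p_ge0 i)).
have ucv := cvg_upper_sum phi (fun n => f n) (Ffun mu) p m.+1
  (fun i _ => fF (p i) (p_ge0 i)).
have e20 : 0 < e / 2 by rewrite divr_gt0.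
move/cvgrPdist_lt : lcv => /(_ _ e20) lcv.
move/cvgrPdist_lt : ucv => /(_ _ e20) ucv.
apply: filterS2 lcv ucv => n; rewrite !ltr_norml => /andP[l1 l2] /andP[u1 u2].
have /andP[nl nu] := Ufun_sums_bound (f n) z p m.+1 p_nd p0 pm.
rewrite -/phi in Vl Vu nl nu.
by apply/andP; split; lra.
Qed.

End Ufun_theory.

(** Convergence at finitely many grid points suffices: from a grid point to the next one [u n] does
    not decrease, while V grows by at most [L] times the mesh. *)
Lemma monotone_cvg_uniform_lower (R : realType) (u : nat -> R -> R) (V : R -> R)
    (L M e : R) : 0 < M -> 0 < e -> 0 <= L ->
  (forall n x y, 0 <= x -> x <= y -> u n x <= u n y) ->
  (forall x y, 0 <= x -> x <= y -> y <= M -> V y - V x <= (y - x) * L) ->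
  (forall x, 0 <= x -> u n x @[n --> \oo] --> V x) ->
  \forall n \near \oo, forall x, 0 <= x <= M -> V x - e <= u n x.
Proof.
move=> M0 e0 L0 u_nd VL uV.
pose m := Num.bound (M * L / (e / 2)).
have e20 : 0 < e / 2 by rewrite divr_gt0.
pose p i : R := M * i%:R / m.+1%:R.
have p_ge0 i : 0 <= p i by rewrite /p divr_ge0 // mulr_ge0 // ltW.
(* The last index [m.+1] is needed for [x = M], which is itself a grid point. *)
have : \forall n \near \oo, forall i : 'I_m.+2, V (p i) - e / 2 <= u n (p i).
  apply: filter_forall => i.
  move/cvgrPdist_le : (uV (p i) (p_ge0 i)) => /(_ _ e20).
  by apply: filterS => n; rewrite ler_norml => /andP[? ?]; lra.
apply: filterS => n un x /andP[x0 xM].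
pose k := Num.truncn (x * m.+1%:R / M).
have /andP[k1 k2] : k%:R <= x * m.+1%:R / M < k.+1%:R.
  by apply: truncn_itv; rewrite divr_ge0 ?(ltW M0) // mulr_ge0.
have pkx : p k <= x.
  by rewrite /p ler_pdivrMr // mulrC -ler_pdivlMr //.
have xpk : x <= p k.+1.
  by rewrite /p ler_pdivlMr // [leRHS]mulrC -ler_pdivrMr // ltW.
have km : (k < m.+2)%N.
  rewrite ltnS -(ler_nat R); apply: le_trans k1 _.
  by rewrite ler_pdivrMr // mulrC ler_wpM2l.
apply: le_trans (u_nd n _ _ (p_ge0 k) pkx).
apply: le_trans (un (Ordinal km)) => /=.
have := VL _ _ (p_ge0 k) pkx xM.
suff : (x - p k) * L <= e / 2 by lra.
apply: (@le_trans _ _ (M / m.+1%:R * L)).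
  rewrite ler_wpM2r // lerBlDl; apply: le_trans xpk _.
  by rewrite /p -natr1 mulrDr mulr1 mulrDl.
rewrite mulrAC ler_pdivrMr // [leRHS]mulrC -ler_pdivrMr //.
rewrite ltW // (lt_trans (archi_boundP _)) ?ltr_nat //.
by rewrite divr_ge0 ?(ltW e20) // mulr_ge0 // ltW.
Qed.

(** * One-sided continuity of H, growth of F, and the last jump of a step function *)

Section Hfun_limits.
Context {R : realType} (mu : {measure set (measurableTypeR R) -> \bar R}).
Hypothesis mu_fin : forall a b : R, (mu `]a, b]%classic < +oo)%E.

Lemma Hfun_right_continuous (z e : R) : 0 < e ->
  exists2 d, 0 < d & Hfun mu (z + d) < Hfun mu z + e.
Proof.
move=> e0; pose A (n : nat) : set R := `]0, z + n.+1%:R^-1]%classic.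
have capA : \bigcap_n A n = `]0, z]%classic.
  apply/seteqP; split=> x /=.
    move=> Ax; have := Ax 0%N I; rewrite /A /= !in_itv /= => /andP[-> _] /=.
    rewrite leNgt; apply/negP => /ltr_add_invr[k kx].
    by have := Ax k I; rewrite /A /= in_itv /= leNgt kx andbF.
  rewrite in_itv /= => /andP[x0 xz] n _; rewrite /A /= in_itv /= x0 /=.
  by rewrite (le_trans xz) // lerDl invr_ge0.
have : (mu \o A) n @[n --> \oo] --> mu (\bigcap_n A n).
  apply: nonincreasing_cvg_mu => //.
  - exact: mu_fin.
  - by move=> i; exact: measurable_itv.
  - by rewrite capA; exact: measurable_itv.
  - move=> i j ij; apply/subsetPset; apply: subset_itvl.
    by rewrite bnd_simp lerD2l lef_pV2 ?posrE // ler_nat.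
rewrite capA -[mu `]0, z]%classic]fineK ?ge0_fin_numE // => /fine_cvgP[_].
move=> /cvgrPdist_lt /(_ _ e0) [N _ /(_ N (leqnn N))].
rewrite /= ltr_norml -/(Hfun mu z) => /andP[h _].
by exists N.+1%:R^-1 => //; rewrite /Hfun -/(A N); move: h; rewrite /Hfun; lra.
Qed.

Lemma Hfun_gt0 : mu [set: measurableTypeR R] <> 0%E -> concentrated_on_pos mu ->
  exists2 z, 0 <= z & 0 < Hfun mu z.
Proof.
move=> mu0 mu_pos; apply: contrapT => noz; apply: mu0.
pose A (n : nat) : set R := `]0, n%:R]%classic.
have H0 n : mu (A n) = 0%E.
  rewrite /A -[mu _]fineK ?ge0_fin_numE //; congr EFin; apply/eqP.
  rewrite eq_le fine_ge0 // andbT leNgt; apply/negP => Hn.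
  by apply: noz; exists n%:R.
have cupA : \bigcup_n A n = `]0, +oo[%classic.
  apply/seteqP; split=> x /=.
    by move=> [n _]; rewrite /A /= !in_itv /= => /andP[->].
  rewrite in_itv /= andbT => x0; exists (Num.bound x) => //.
  by rewrite /A /= in_itv /= x0 /= ltW // archi_boundP // ltW.
have cvA : (mu \o A) n @[n --> \oo] --> mu (\bigcup_n A n).
  apply: nondecreasing_cvg_mu => //.
  - by move=> i; exact: measurable_itv.
  - by rewrite cupA; exact: measurable_itv.
  - move=> i j ij; apply/subsetPset; apply: subset_itvl.
    by rewrite bnd_simp ler_nat.
have mupos : mu `]0, +oo[%classic = 0%E.
  rewrite -cupA; apply: (cvg_unique _ cvA) => //.
  by rewrite (_ : mu \o A = cst 0%E); [exact: cvg_cst|apply/funext => n /=].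
apply/eqP; rewrite eq_le measure_ge0 andbT.
rewrite -(setUv (`]0, +oo[%classic : set R)).
apply: le_trans (measureU2 _ _ _) _ => //.
  by apply: measurableC.
by rewrite [X in (X + _)%E]mupos [X in (_ + X)%E]mu_pos adde0.
Qed.

Lemma Ffun_unbounded (c M : R) :
  mu [set: measurableTypeR R] <> 0%E -> concentrated_on_pos mu ->
  exists2 t, M <= t & c < Ffun mu t.
Proof.
move=> mu0 mu_pos; have [z z0 Hz] := Hfun_gt0 mu0 mu_pos.
(* For [t >= z + r ^+ 2] the kernel is at least [2 * r] on ]0, z], so F at [t] is at least
   [2 * r * Hfun mu z], which exceeds [c]. *)
pose r := (`|c| + 1) / Hfun mu z.
have r0 : 0 < r by rewrite divr_gt0 // ltr_wpDl.
pose t := z + `|M| + r ^+ 2.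
have zt : z <= t by rewrite /t -addrA lerDl addr_ge0 // sqr_ge0.
exists t.
  by rewrite /t (le_trans (ler_norm M)) // addrAC lerDr addr_ge0 // sqr_ge0.
have t0 := le_trans z0 zt.
rewrite (FfunE mu mu_fin t t) //.
have ck := @continuous_sqrt_kernel R t.
rewrite (Rintegral_oc_cat _ mu _ _ _ _ z0 zt (mu_fin _ _) ck).
apply: (@lt_le_trans _ _ (2 * r * Hfun mu z + 0)).
  rewrite addr0 /r mulrA divfK ?gt_eqF //.
  by rewrite (le_lt_trans (ler_norm c)) //; have := normr_ge0 c; lra.
apply: lerD; last first.
  by apply: Rintegral_ge0 => h _; rewrite mulr_ge0 // sqrtr_ge0.
apply: Rintegral_oc_ge_cst => // h /andP[_ hz].
rewrite ler_pM2l // -[leLHS]ger0_norm ?(ltW r0) // -sqrtr_sqr ler_wsqrtr //.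
by rewrite /t; have := normr_ge0 M; lra.
Qed.

End Hfun_limits.

(** If all jumps were at or before [M], then [f] would be constant on [M, K]. *)
Lemma jump_locations_lt_last (R : realType) (f : R -> R) (s : seq R) (M K : R) :
  jump_locations f s -> 0 <= M -> M <= K -> f M < f K -> M < last 0 s.
Proof.
move=> [ps _ cst_f] M0 MK; rewrite ltNge [_ <= _]leNgt => fMK.
have last_max (x : R) (r : seq R) : path <%R x r ->
    x <= last x r /\ {in r, forall y, y <= last x r}.
  elim: r x => [|a r IH] x /=; first by [].
  move=> /andP[xa /IH[al rl]]; split; first exact: le_trans (ltW xa) al.
  by move=> y; rewrite inE => /predU1P[->|/rl].
rewrite ltNge; apply/negP => sM.
move: fMK; rewrite (cst_f M K) // ?ltxx //.
move=> y /(proj2 (last_max 0 s ps)) ys; rewrite negb_and -leNgt.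
by rewrite (le_trans ys sM).
Qed.

(** * The greatest convex minorant of a nonnegative function vanishing at 0 *)

Section gcm_right_derivative.
Context {R : realType} (U : R -> R) (M z : R).
Hypotheses (U_ge0 : forall x, 0 <= U x) (U0 : U 0 = 0).
Hypotheses (z_ge0 : 0 <= z) (zM : z < M).
Implicit Types x y e : R.
Let g := gcm U 0 M.

(** The constant 0 is a convex minorant, so [gcm] does not take its default value. *)
Let g_gcm : is_gcm U 0 M g.
Proof.
apply: gcmP; exists (cst 0); split=> [t x y _ _|x _ /=]; last exact: U_ge0.
by rewrite convRE /= !mulr0 addr0.
Qed.

Let g_convex : convex_function (`[0, M] : set R^o) g.
Proof. by case: g_gcm => -[]. Qed.

Let M_ge0 : 0 <= M := le_trans z_ge0 (ltW zM).

Lemma gcm_ge0 x : 0 <= x <= M -> 0 <= g x.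
Proof.
case: g_gcm => _ gmax xM; apply: (gmax (cst 0)) => //.
split=> [t u v _ _|u _ /=]; last exact: U_ge0.
by rewrite convRE /= !mulr0 addr0.
Qed.

Lemma gcm_at0 : g 0 = 0.
Proof.
apply/eqP; rewrite eq_le gcm_ge0 ?lexx // andbT -[leRHS]U0.
by case: g_gcm => -[_ gU] _; apply: gU; rewrite lexx.
Qed.

(** Convexity and [g 0 = 0] give [g x <= x / y * g y], and [g y] is nonnegative. *)
Lemma gcm_homo x y : 0 <= x -> x <= y -> y <= M -> g x <= g y.
Proof.
rewrite le_eqVlt => /predU1P[<-|x0].
  by move=> y0 yM; rewrite gcm_at0 gcm_ge0 // y0.
rewrite le_eqVlt => /predU1P[<-//|xy] yM.
have := convex_three_points g 0 M 0 x y g_convex (lexx 0) x0 xy yM.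
rewrite gcm_at0 !subr0 => gxy.
have gy : 0 <= g y by rewrite gcm_ge0 // yM andbT ltW // (lt_trans x0).
have y0 := lt_trans x0 xy.
rewrite -(ler_pM2r y0); apply: le_trans gxy _.
by rewrite ler_wpM2l // ltW.
Qed.

Lemma gcm_right_derivative_ge0 : 0 <= right_derivative g z.
Proof.
have e0 : 0 < M - z by rewrite subr_gt0.
have ze : z + (M - z) <= M by rewrite addrC subrK.
have := right_derivative_bounds g 0 M z _ 0 g_convex z_ge0 e0 ze.
case/(_ _)/andP => // x x0 xe.
by rewrite divr_ge0 ?(ltW x0) // subr_ge0 gcm_homo // ?lerDl ?(ltW x0) //; lra.
Qed.

Lemma gcm_right_derivative_le e : 0 < e -> z + e <= M ->
  right_derivative g z <= (g (z + e) - g z) / e.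
Proof.
move=> e0 ze.
have := right_derivative_bounds g 0 M z e 0 g_convex z_ge0 e0 ze.
case/(_ _)/andP => // x x0 xe.
by rewrite divr_ge0 ?(ltW x0) // subr_ge0 gcm_homo // ?lerDl ?(ltW x0) //; lra.
Qed.

(** The slope of the chord from [y] to [z] is below that of every chord from [z] to the right, so it
    serves as the lower bound [B]. *)
Lemma gcm_right_derivative_ge y : 0 <= y -> y < z ->
  (g z - g y) / (z - y) <= right_derivative g z.
Proof.
move=> y0 yz.
have e0 : 0 < M - z by rewrite subr_gt0.
have ze : z + (M - z) <= M by rewrite addrC subrK.
have := right_derivative_bounds g 0 M z _ _ g_convex z_ge0 e0 ze.
case/(_ ((g z - g y) / (z - y)) _)/andP => // x x0 xe.
rewrite ler_pdivlMr // mulrAC ler_pdivrMr ?subr_gt0 //.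
have := convex_three_points g 0 M y z (z + x) g_convex y0 yz.
by rewrite ltrDl => /(_ x0) h; have := h (_ : z + x <= M); lra.
Qed.

Lemma gcm_le x : 0 <= x <= M -> g x <= U x.
Proof. by case: g_gcm => -[_ gU] _; exact: gU. Qed.

Lemma convex_minorant_le_gcm V x : convex_minorant U 0 M V -> 0 <= x <= M ->
  V x <= g x.
Proof. by case: g_gcm => _ gmax cV; exact: gmax. Qed.

End gcm_right_derivative.

(** * Limits of the isotonic estimator along one convergent path *)

Lemma limn_esup_le_near (R : realType) (u : nat -> \bar R) (c : \bar R) :
  (\forall n \near \oo, (u n <= c)%E) -> (limn_esup u <= c)%E.
Proof.
move=> uc; rewrite /limn_esup limf_esupE.
apply: (@le_trans _ _ (ereal_sup [set u n | n in [set n | (u n <= c)%E]])).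
  by apply: ereal_inf_lbound; exists [set n | (u n <= c)%E].
by apply: ge_ereal_sup => _ [n un <-].
Qed.

Lemma limn_einf_ge_near (R : realType) (u : nat -> \bar R) (c : \bar R) :
  (\forall n \near \oo, (c <= u n)%E) -> (c <= limn_einf u)%E.
Proof.
move=> cu; rewrite /limn_einf leeNr; apply: limn_esup_le_near.
by apply: filterS cu => n; rewrite leeN2.
Qed.

Lemma cvg_left_limit_Hfun (R : realType)
    (mu : {measure set (measurableTypeR R) -> \bar R}) (z : R) :
  (forall a b : R, (mu `]a, b]%classic < +oo)%E) ->
  Hfun mu x @[x --> z^'-] --> left_limit (Hfun mu) z.
Proof.
move=> mu_fin; apply: nondecreasing_at_left_is_cvgr.
  by near=> x => y w _ _; exact: Hfun_homo.
near=> x; exists (Hfun mu z) => _ [y /= + <-].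
by rewrite in_itv /= => /andP[_ yz]; apply: Hfun_homo => //; exact: ltW.
Unshelve. all: by end_near. Qed.

Section isotonic_estimator_limits.
Context {R : realType} (mu : {measure set (measurableTypeR R) -> \bar R}).
Hypotheses (mu_neq0 : mu [set: measurableTypeR R] <> 0%E)
  (mu_lf : locally_finite mu) (mu_pos : concentrated_on_pos mu).
Context (f : nat -> cumulative R R) (s : nat -> seq R) (M z : R).
Implicit Types x y e : R.
Hypotheses (f_jump : forall n, jump_locations (f n) (s n)).
Hypotheses (f_cvg : forall y : R, 0 <= y -> f n y @[n --> \oo] --> Ffun mu y).
Hypotheses (M_gt0 : 0 < M) (z_ge0 : 0 <= z) (z_ltM : z < M).

Let mu_fin := locally_finite_oc R mu mu_lf.
Let V := iterated_Hfun mu.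
Let Hhat n := isotonic_estimator (f n) (s n) M z.
Let g n := gcm (Ufun (f n)) 0 M.

(** Some [K] beyond [M] has F(K) > F(M); eventually [f n K > f n M], which forces a jump after
    [M]. *)
Lemma last_jump_gt : \forall n \near \oo, M < last 0 (s n).
Proof.
have [K MK FK] := Ffun_unbounded mu mu_fin (Ffun mu M) M mu_neq0 mu_pos.
have M0 := ltW M_gt0.
have : (f n K - f n M) @[n --> \oo] --> Ffun mu K - Ffun mu M.
  by apply: cvgB; apply: f_cvg => //; exact: le_trans MK.
have dF : 0 < Ffun mu K - Ffun mu M by rewrite subr_gt0.
move=> /cvgrPdist_lt/(_ _ dF); apply: filterS => n.
rewrite ltr_norml => /andP[_ ?].
apply: (jump_locations_lt_last _ (f n) (s n) M K (f_jump n) M0 MK).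
by lra.
Qed.

Lemma HhatE : \forall n \near \oo, Hhat n = right_derivative (g n) z.
Proof.
apply: filterS last_jump_gt => n sM.
by rewrite /Hhat /isotonic_estimator min_r ?z_ltM // ltW.
Qed.

Lemma convex_iterated_Hfun : convex_function (`[0, M] : set R^o) V.
Proof.
apply: (subgradient_convex V (Hfun mu)).
  by move=> x y; exact: Hfun_homo.
by move=> x y x0 xy _; exact: iterated_Hfun_increment.
Qed.

Lemma gcm_ge_iterated_Hfun e : 0 < e ->
  \forall n \near \oo, forall x, 0 <= x <= M -> V x - e <= g n x.
Proof.
move=> e0.
have H0 : 0 <= Hfun mu M by rewrite fine_ge0.
have V_lip x y : 0 <= x -> x <= y -> y <= M -> V y - V x <= (y - x) * Hfun mu M.
  move=> x0 xy yM; have /andP[_ /le_trans] := iterated_Hfun_increment mu mu_fin x y x0 xy.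
  by apply; rewrite ler_wpM2l ?subr_ge0 // Hfun_homo.
have U_nd n x y : 0 <= x -> x <= y -> Ufun (f n) x <= Ufun (f n) y.
  exact: Ufun_homo.
have U_cvg x : 0 <= x -> Ufun (f n) x @[n --> \oo] --> V x.
  by move=> x0; exact: cvg_Ufun.
have := monotone_cvg_uniform_lower R (fun n => Ufun (f n)) V (Hfun mu M) M e
  M_gt0 e0 H0 U_nd V_lip U_cvg.
apply: filterS => n VU x xM.
apply: (convex_minorant_le_gcm _ _ (Ufun_ge0 (f n)) (fun x => V x - e)) => //.
split=> // t u v uM vM.
have := convex_iterated_Hfun t u v uM vM; rewrite !convRE /= => h.
have -> : t%:num * (V u - e) + unstable.onem t%:num * (V v - e) =
  t%:num * V u + unstable.onem t%:num * V v - e by rewrite /unstable.onem; ring.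
by rewrite lerD2r.
Qed.

Lemma Hhat_le e : 0 < e -> \forall n \near \oo, Hhat n <= Hfun mu z + e.
Proof.
move=> e0; have e20 : 0 < e / 2 by rewrite divr_gt0.
have [d0 d0_gt0 Hd0] := Hfun_right_continuous mu mu_fin z (e / 2) e20.
(* The step keeps [z + d] in [0, M] and H at [z + d] within [e / 2] of H at [z]. *)
pose d := Num.min d0 (M - z).
have d_gt0 : 0 < d by rewrite lt_min d0_gt0 subr_gt0.
have zd : z + d <= M by rewrite -lerBrDl ge_min lexx orbT.
have Hd : Hfun mu (z + d) <= Hfun mu z + e / 2.
  rewrite (le_trans _ (ltW Hd0)) //; apply: Hfun_homo => //.
  by rewrite lerD2l ge_min lexx.
(* The errors in [V z - r <= g n z] and in U_n at [z + d] add up to [2 * r], which contributes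
   [e / 2] after division by [d]. *)
pose r := d * (e / 4).
have r_gt0 : 0 < r by rewrite mulr_gt0 // divr_gt0.
have zd0 : 0 <= z + d by rewrite addr_ge0 // ltW.
have /cvgrPdist_le/(_ _ r_gt0) Ucv := cvg_Ufun mu f (z + d) mu_fin zd0 f_cvg.
apply: filterS3 HhatE (gcm_ge_iterated_Hfun r r_gt0) Ucv => n -> gV.
rewrite ler_norml => /andP[Ul _].
have U_ge0 := Ufun_ge0 (f n); have U0 := Ufun0 (f n).
apply: le_trans (gcm_right_derivative_le _ _ _ U_ge0 U0 z_ge0 z_ltM d d_gt0 zd) _.
rewrite ler_pdivrMr // -/(g n).
have := gV z; rewrite z_ge0 (ltW z_ltM) => /(_ isT) gz.
have gzd : g n (z + d) <= Ufun (f n) (z + d).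
  by apply: gcm_le => //; rewrite zd0.
have zzd : z <= z + d by rewrite lerDl ltW.
have /andP[_ Vzd] := iterated_Hfun_increment mu mu_fin z (z + d) z_ge0 zzd.
have dH : d * Hfun mu (z + d) <= d * (Hfun mu z + e / 2) by rewrite ler_pM2l.
have zdz : z + d - z = d by lra.
rewrite -/V zdz in Vzd.
by rewrite /r -/V in Ul gz; lra.
Qed.

Lemma Hhat_ge y e : y < z -> 0 < e ->
  \forall n \near \oo, Hfun mu y - e <= Hhat n.
Proof.
move=> yz e0.
(* A negative [y] gives no chord inside [0, M]; there H vanishes and nonnegativity of the derivative
   suffices. This covers [z = 0]. *)
have [y0|y0] := ltP y 0.
  apply: filterS HhatE => n ->.
  apply: (@le_trans _ _ 0); first by rewrite Hfun_nonpos ?(ltW y0) // sub0r oppr_le0 ltW.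
  exact: (gcm_right_derivative_ge0 _ _ _ (Ufun_ge0 (f n)) (Ufun0 (f n))).
have d_gt0 : 0 < z - y by rewrite subr_gt0.
(* Again the two errors total [2 * r], here [e] after division by [z - y]. *)
pose r := (z - y) * (e / 2).
have r_gt0 : 0 < r by rewrite mulr_gt0 // divr_gt0.
have /cvgrPdist_le/(_ _ r_gt0) Ucv := cvg_Ufun mu f y mu_fin y0 f_cvg.
apply: filterS3 HhatE (gcm_ge_iterated_Hfun r r_gt0) Ucv => n -> gV.
rewrite ler_norml => /andP[Ul _].
have U_ge0 := Ufun_ge0 (f n); have U0 := Ufun0 (f n).
have gd := gcm_right_derivative_ge _ _ _ U_ge0 z_ge0 z_ltM y y0 yz.
apply: le_trans gd.
rewrite ler_pdivlMr // -/(g n).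
have := gV z; rewrite z_ge0 (ltW z_ltM) => /(_ isT) gz.
have gy : g n y <= Ufun (f n) y.
  by apply: gcm_le => //; rewrite y0 /= ltW // (lt_trans yz).
have /andP[Vzy _] := iterated_Hfun_increment mu mu_fin y z y0 (ltW yz).
by rewrite /r -/V in Ul gz Vzy; lra.
Qed.

(** Some [y < z] has H(y) within [e / 2] of the left limit; [Hhat_ge] at this [y] costs the other
    half. *)
Lemma Hhat_ge_left_limit e : 0 < e ->
  \forall n \near \oo, left_limit (Hfun mu) z - e <= Hhat n.
Proof.
move=> e0; have e20 : 0 < e / 2 by rewrite divr_gt0.
have /cvgrPdist_lt/(_ _ e20) Hl := cvg_left_limit_Hfun R mu z mu_fin.
have [y [yz Hy]] : exists y, y < z /\ `|left_limit (Hfun mu) z - Hfun mu y| < e / 2.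
  apply: (@filter_ex _ (z^'-)); apply: filterI => //.
  exact: nbhs_left_lt.
move: Hy; rewrite ltr_norml => /andP[_ Hy].
by apply: filterS (Hhat_ge y (e / 2) yz e20) => n; lra.
Qed.

Lemma Hhat_limn_bounds :
  [/\ ((left_limit (Hfun mu) z)%:E <= limn_einf (fun n => (Hhat n)%:E))%E,
      (limn_einf (fun n => (Hhat n)%:E) <= limn_esup (fun n => (Hhat n)%:E))%E &
      (limn_esup (fun n => (Hhat n)%:E) <= (Hfun mu z)%:E)%E].
Proof.
split; last 1 first.
- apply/lee_addgt0Pr => e e0; apply: limn_esup_le_near.
  by apply: filterS (Hhat_le e e0) => n; rewrite -EFinD lee_fin.
- apply/lee_addgt0Pr => e e0; rewrite -leeBlDr // -EFinB.
  apply: limn_einf_ge_near.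
  by apply: filterS (Hhat_ge_left_limit e e0) => n; rewrite lee_fin.
- exact: limn_einf_sup.
Qed.

Lemma Hhat_cvg : {for z, continuous (Hfun mu)} ->
  Hhat n @[n --> \oo] --> Hfun mu z.
Proof.
move=> Hz.
have lz : left_limit (Hfun mu) z = Hfun mu z.
  by apply: cvg_lim => //; exact: cvg_at_left_filter.
apply/cvgrPdist_le => e e0.
apply: filterS2 (Hhat_le e e0) (Hhat_ge_left_limit e e0) => n.
by rewrite lz ler_norml => ? ?; apply/andP; split; lra.
Qed.

End isotonic_estimator_limits.


Theorem theorem14 (R : realType)
  (mu : {measure set (measurableTypeR R) -> \bar R})
  (mu_neq0 : mu [set: measurableTypeR R] <> 0%E)
  (mu_lf : locally_finite mu)
  (mu_pos : concentrated_on_pos mu)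
  (d : measure_display) (T : measurableType d) (P : probability T R)
  (Fbar : nat -> T -> cumulative R R) (h : nat -> T -> seq R)
  (Fbar_pc : piecewise_constant_estimator Fbar h)
  (Fbar_sc : strongly_consistent P Fbar (Ffun mu))
  (M : R) (M_gt0 : 0 < M) (z : R) (z_ge0 : 0 <= z) (z_ltM : z < M) :
  let Hhat n w := isotonic_estimator (Fbar n w) (h n w) M z in
  {ae P, forall w,
    [/\ ((left_limit (Hfun mu) z)%:E <= limn_einf (fun n => (Hhat n w)%:E))%E,
        (limn_einf (fun n => (Hhat n w)%:E) <=
          limn_esup (fun n => (Hhat n w)%:E))%E &
        (limn_esup (fun n => (Hhat n w)%:E) <= (Hfun mu z)%:E)%E]} /\
  ({for z, continuous (Hfun mu)} ->
    {ae P, forall w, Hhat n w @[n --> \oo] --> Hfun mu z}).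
Proof.
move=> Hhat; have [_ _ jumps] := Fbar_pc; split=> [|Hz].
- by apply: filterS Fbar_sc => w cv; exact: (Hhat_limn_bounds mu).
- by apply: filterS Fbar_sc => w cv; exact: (Hhat_cvg mu).
Qed.
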